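(* Let $\{(\boldsymbol{x}_j,y_j)\}_{j=1}^n\subset\mathbb{R}^d\times\mathbb{R}$ be a training set and let $f\in\mathcal{F}_k$ be a stable solution for SGD with step size $\eta>0$. Assume that none of the knots of $f$ contains a training point $\boldsymbol{x}_j$. Then $$\|f\|_{\mathcal{R},g}\le \frac{1}{\eta}-\frac{1}{2},$$ where $$\|f\|_{\mathcal{R},g}=\int_{\mathbb{S}^{d-1}\times\mathbb{R}}\big|[(\mathcal{R}^* )^{-1}\Delta f](\boldsymbol{v},b)\big|\,g(\boldsymbol{v},b)\,\mathrm{d}s(\boldsymbol{v})\,\mathrm{d}b,$$ with $g(\boldsymbol{v},b)=\min\big(\tilde g(\boldsymbol{v},b),\tilde g(-\boldsymbol{v},-b)\big)$ and $$\tilde g(\boldsymbol{v},b)=\mathbb{P}^2(\boldsymbol{X}^\top\boldsymbol{v}>b)\,\mathbb{E}\big[\boldsymbol{X}^\top\boldsymbol{v}-b\,\big|\,\boldsymbol{X}^\top\boldsymbol{v}>b\big]\sqrt{\big\|\mathbb{E}[\boldsymbol{X}\mid\boldsymbol{X}^\top\boldsymbol{v}>b]\big\|^2+1},$$ $\boldsymbol{X}$ being drawn uniformly at random from $\{\boldsymbol{x}_j\}_{j=1}^n$.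
   Context: $\sigma(t)=\max(t,0)$. $\mathcal{F}_k$ is the set of functions $f(\boldsymbol{x})=\sum_{i=1}^k w^{(2)}_i\sigma(\boldsymbol{x}^\top\boldsymbol{w}^{(1)}_i+b^{(1)}_i)+b^{(2)}$ on $\mathbb{R}^d$; the parameter vector $\boldsymbol{\theta}=(\boldsymbol{w}^{(1)}_1,\dots,\boldsymbol{w}^{(1)}_k,\boldsymbol{b}^{(1)},\boldsymbol{w}^{(2)},b^{(2)})\in\mathbb{R}^{(d+2)k+1}$ determines $f_{\boldsymbol\theta}\in\mathcal{F}_k$, and a minimum $\boldsymbol\theta^*$ ''corresponds to'' $f$ if $f_{\boldsymbol\theta^*}=f$. A knot of $f$ is a boundary between two linear pieces of $f$. The loss is $\mathcal{L}(\boldsymbol\theta)=\frac{1}{2n}\sum_{j=1}^n(f_{\boldsymbol\theta}(\boldsymbol{x}_j)-y_j)^2=\frac1n\sum_j\ell_j(\boldsymbol\theta)$; a solution is $f\in\mathcal{F}_k$ with $f(\boldsymbol{x}_j)=y_j$ for all $j$. SGD: $\boldsymbol\theta_{t+1}=\boldsymbol\theta_t-\eta\nabla\hat{\mathcal{L}}_t(\boldsymbol\theta_t)$, $\hat{\mathcal{L}}_t=\frac1B\sum_{j\in\mathfrak{B}_t}\ell_j$, batches $\mathfrak{B}_t$ of size $B$ drawn uniformly from the dataset independently across iterations. A twice differentiable minimum $\boldsymbol\theta^*$ of $\mathcal{L}$ is $\varepsilon$ linearly stable if for the linearized dynamics $\boldsymbol\theta_{t+1}=\boldsymbol\theta_t-\eta(\nabla\hat{\mathcal{L}}_t(\boldsymbol\theta^*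 )+\nabla^2\hat{\mathcal{L}}_t(\boldsymbol\theta^* )(\boldsymbol\theta_t-\boldsymbol\theta^* ))$ and every $\boldsymbol\theta_0$ in the $\varepsilon$-ball around $\boldsymbol\theta^*$, $\limsup_{t\to\infty}\mathbb{E}\|\boldsymbol\theta_t-\boldsymbol\theta^*\|\le\varepsilon$. A solution $f$ is stable for step size $\eta$ if some minimum $\boldsymbol\theta^*$ of $\mathcal{L}$ corresponding to $f$ is linearly stable for SGD with step size $\eta$. Radon transform: $\mathcal{R}\varphi(\boldsymbol{v},b)=\int_{\boldsymbol{v}^\top\boldsymbol{x}=b}\varphi\,\mathrm{d}s$ for $(\boldsymbol v,b)\in\mathbb{S}^{d-1}\times\mathbb{R}$; dual $\mathcal{R}^*\psi(\boldsymbol{x})=\int_{\mathbb{S}^{d-1}}\psi(\boldsymbol v,\boldsymbol v^\top\boldsymbol x)\,\mathrm{d}s(\boldsymbol v)$. $\Delta f$ is the distributional Laplacian, and $(\mathcal{R}^* )^{-1}\Delta f$ is the distribution on $\mathbb{S}^{d-1}\times\mathbb{R}$ defined by $\langle(\mathcal{R}^* )^{-1}\Delta f,\phi\rangle=\langle\Delta f,\mathcal{R}^{-1}\phi\rangle$ for $\phi$ in $\mathcal{S}_H$, the image of the Schwartz space $\mathcal{S}(\mathbb{R}^d)$ under $\mathcal{R}$. For $f(\boldsymbol x)=\sum_{i}a_i\sigma(\boldsymbol v_i^\top\boldsymbol x-b_i)+\boldsymbol{q}^\top\boldsymbol x+c$ with $\|\boldsymbol v_i\|=1$, one has $(\mathcal{R}^*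 )^{-1}\Delta f=\sum_i a_i\delta_{(\boldsymbol v_i,b_i)}$, and the integral $\|f\|_{\mathcal{R},g}$ is the integral of $g$ against the total variation measure of this measure (equal to $\sum_i|a_i|g(\boldsymbol v_i,b_i)$ when the pairs $(\boldsymbol v_i,b_i)$ are distinct and the $a_i\neq0$). *)

(* Defs.v *)
From mathcomp Require Import all_boot all_order all_algebra.
From mathcomp Require Import reals.
Set Implicit Arguments. Unset Strict Implicit. Unset Printing Implicit Defensive.
Import Order.TTheory GRing.Theory Num.Theory.
Local Open Scope ring_scope.

Section Defs.
Variable R : realType.

Definition relu (t : R) : R := Num.max t 0.

Definition dotv (m : nat) (u v : 'cV[R]_m) : R := \sum_(i < m) u i 0 * v i 0.
Definition normv (m : nat) (u : 'cV[R]_m) : R := Num.sqrt (dotv u u).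

Definition npar (d k : nat) : nat := ((d + 2) * k).+1.

(* Parameter vector theta = (w^(1)_1,...,w^(1)_k, b^(1), w^(2), b^(2)),
   flattened in this order into R^((d+2)k+1). *)
Definition par_w1 (d k : nat) (th : 'cV[R]_(npar d k)) (i : 'I_k) (l : 'I_d) : R :=
  th (inord (i * d + l)) 0.
Definition par_b1 (d k : nat) (th : 'cV[R]_(npar d k)) (i : 'I_k) : R :=
  th (inord (k * d + i)) 0.
Definition par_w2 (d k : nat) (th : 'cV[R]_(npar d k)) (i : 'I_k) : R :=
  th (inord (k * d + k + i)) 0.
Definition par_b2 (d k : nat) (th : 'cV[R]_(npar d k)) : R :=
  th (inord (k * d + k + k)) 0.

Definition net (d k : nat) (th : 'cV[R]_(npar d k)) (x : 'cV[R]_d) : R :=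
  \sum_(i < k) par_w2 th i * relu (\sum_(l < d) x l 0 * par_w1 th i l + par_b1 th i)
  + par_b2 th.

Definition loss_j (d k n : nat) (x : 'I_n -> 'cV[R]_d) (y : 'I_n -> R)
  (j : 'I_n) (th : 'cV[R]_(npar d k)) : R :=
  (net th (x j) - y j) ^+ 2 / 2.
Definition loss (d k n : nat) (x : 'I_n -> 'cV[R]_d) (y : 'I_n -> R)
  (th : 'cV[R]_(npar d k)) : R :=
  (\sum_(j < n) loss_j x y j th) / n%:R.
Definition batch_loss (d k n B : nat) (x : 'I_n -> 'cV[R]_d) (y : 'I_n -> R)
  (S : {set 'I_n}) (th : 'cV[R]_(npar d k)) : R :=
  (\sum_(j in S) loss_j x y j th) / B%:R.

Definition has_gradient (p : nat) (F : 'cV[R]_p -> R) (th gr : 'cV[R]_p) : Prop :=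
  forall eps : R, 0 < eps -> exists rho : R, 0 < rho /\
    forall h : 'cV[R]_p, normv h < rho ->
      `|F (th + h) - F th - dotv gr h| <= eps * normv h.

Definition has_jacobian (p : nat) (G : 'cV[R]_p -> 'cV[R]_p) (th : 'cV[R]_p)
  (H : 'M[R]_p) : Prop :=
  forall eps : R, 0 < eps -> exists rho : R, 0 < rho /\
    forall h : 'cV[R]_p, normv h < rho ->
      normv (G (th + h) - G th - H *m h) <= eps * normv h.

Definition twice_diff_at (p : nat) (F : 'cV[R]_p -> R) (th : 'cV[R]_p)
  (G : 'cV[R]_p -> 'cV[R]_p) (H : 'M[R]_p) : Prop :=
  (exists delta : R, 0 < delta /\
     forall th' : 'cV[R]_p, normv (th' - th) < delta -> has_gradient F th' (G th'))
  /\ has_jacobian G th H.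

Definition is_batch (n B : nat) (S : {set 'I_n}) : bool := #|S| == B.
Definition nbatches (n B : nat) : nat := #|[set S : {set 'I_n} | is_batch B S]|.

Definition lin_step (p : nat) (eta : R) (thstar : 'cV[R]_p)
  (g : 'cV[R]_p) (H : 'M[R]_p) (th : 'cV[R]_p) : 'cV[R]_p :=
  th - eta *: (g + H *m (th - thstar)).
Definition lin_traj (p n : nat) (eta : R) (thstar : 'cV[R]_p)
  (gS : {set 'I_n} -> 'cV[R]_p) (HS : {set 'I_n} -> 'M[R]_p)
  (th0 : 'cV[R]_p) (s : seq {set 'I_n}) : 'cV[R]_p :=
  foldl (fun th S => lin_step eta thstar (gS S) (HS S) th) th0 s.

(* E ||theta_t - theta*||, batches drawn uniformly and independently:
   average over all t-sequences of batches *)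
Definition exp_dist (p n B : nat) (eta : R) (thstar : 'cV[R]_p)
  (gS : {set 'I_n} -> 'cV[R]_p) (HS : {set 'I_n} -> 'M[R]_p)
  (th0 : 'cV[R]_p) (t : nat) : R :=
  (\sum_(s : t.-tuple {set 'I_n} | all (is_batch B) s)
      normv (lin_traj eta thstar gS HS th0 s - thstar))
  / (nbatches n B)%:R ^+ t.

Definition is_min (p : nat) (F : 'cV[R]_p -> R) (th : 'cV[R]_p) : Prop :=
  exists delta : R, 0 < delta /\
    forall th' : 'cV[R]_p, normv (th' - th) < delta -> F th <= F th'.

(* eps linear stability of a twice differentiable minimum thstar
   (all batch losses twice differentiable at thstar);
   limsup_t E||theta_t - thstar|| <= eps is spelled out. *)
Definition eps_lin_stable (d k n B : nat) (x : 'I_n -> 'cV[R]_d) (y : 'I_n -> R)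
  (eta eps : R) (thstar : 'cV[R]_(npar d k)) : Prop :=
  is_min (loss x y) thstar /\
  exists (GS : {set 'I_n} -> 'cV[R]_(npar d k) -> 'cV[R]_(npar d k))
         (HS : {set 'I_n} -> 'M[R]_(npar d k)),
    (forall S : {set 'I_n}, is_batch B S ->
        twice_diff_at (batch_loss B x y S) thstar (GS S) (HS S)) /\
    forall th0 : 'cV[R]_(npar d k), normv (th0 - thstar) <= eps ->
      forall e : R, eps < e -> exists T : nat, forall t : nat, (T <= t)%N ->
        exp_dist B eta thstar (fun S => GS S thstar) HS th0 t <= e.

Definition lin_stable (d k n B : nat) (x : 'I_n -> 'cV[R]_d) (y : 'I_n -> R)
  (eta : R) (thstar : 'cV[R]_(npar d k)) : Prop :=
  exists eps : R, 0 < eps /\ eps_lin_stable B x y eta eps thstar.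

Definition stable_solution (d k n B : nat) (x : 'I_n -> 'cV[R]_d) (y : 'I_n -> R)
  (eta : R) (f : 'cV[R]_d -> R) : Prop :=
  (forall j : 'I_n, f (x j) = y j) /\
  exists thstar : 'cV[R]_(npar d k),
    (forall z, net thstar z = f z) /\ lin_stable B x y eta thstar.

Definition on_knot (d : nat) (f : 'cV[R]_d -> R) (x0 : 'cV[R]_d) : Prop :=
  ~ exists delta : R, 0 < delta /\ exists (q : 'cV[R]_d) (c : R),
      forall z : 'cV[R]_d, normv (z - x0) < delta -> f z = dotv q z + c.

(* Canonical representation
   f(x) = sum_i a_i relu(v_i^T x - b_i) + q^T x + c, |v_i| = 1, a_i <> 0,
   and the hyperplanes {v_i^T x = b_i} pairwise distinct
   ((v_i,b_i) <> (v_j,b_j) and (v_i,b_i) <> (-v_j,-b_j) for i <> j). *)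
Definition canonical_rep (d m : nat) (f : 'cV[R]_d -> R) (a : 'I_m -> R)
  (v : 'I_m -> 'cV[R]_d) (b : 'I_m -> R) (q : 'cV[R]_d) (c : R) : Prop :=
  (forall i, normv (v i) = 1) /\ (forall i, a i != 0) /\
  (forall i j, i != j -> (v i, b i) != (v j, b j) /\ (v i, b i) != (- v j, - b j)) /\
  (forall z, f z = \sum_(i < m) a i * relu (dotv (v i) z - b i) + dotv q z + c).

Definition active (d n : nat) (x : 'I_n -> 'cV[R]_d) (v : 'cV[R]_d) (b : R) :
  {set 'I_n} := [set j | b < dotv (x j) v].
Definition prob_act (d n : nat) (x : 'I_n -> 'cV[R]_d) (v : 'cV[R]_d) (b : R) : R :=
  #|active x v b|%:R / n%:R.
Definition cond_margin (d n : nat) (x : 'I_n -> 'cV[R]_d) (v : 'cV[R]_d) (b : R) : R :=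
  (\sum_(j in active x v b) (dotv (x j) v - b)) / #|active x v b|%:R.
Definition cond_mean (d n : nat) (x : 'I_n -> 'cV[R]_d) (v : 'cV[R]_d) (b : R) :
  'cV[R]_d :=
  (#|active x v b|%:R)^-1 *: \sum_(j in active x v b) x j.

Definition gtilde (d n : nat) (x : 'I_n -> 'cV[R]_d) (v : 'cV[R]_d) (b : R) : R :=
  prob_act x v b ^+ 2 * cond_margin x v b
  * Num.sqrt (normv (cond_mean x v b) ^+ 2 + 1).

Definition gw (d n : nat) (x : 'I_n -> 'cV[R]_d) (v : 'cV[R]_d) (b : R) : R :=
  Num.min (gtilde x v b) (gtilde x (- v) (- b)).

(* ||f||_{R,g} evaluated on a canonical representation *)
Definition rnorm_rep (d n m : nat) (x : 'I_n -> 'cV[R]_d) (a : 'I_m -> R)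
  (v : 'I_m -> 'cV[R]_d) (b : 'I_m -> R) : R :=
  \sum_(i < m) `|a i| * gw x (v i) (b i).

End Defs.

(* Main.v *)
Require Import Defs.
From mathcomp Require Import all_boot all_order all_algebra.
From mathcomp Require Import reals.
From mathcomp Require Import perm ring lra zify.
Import Order.TTheory GRing.Theory Num.Theory.
Local Open Scope ring_scope.

Set Implicit Arguments.
Unset Strict Implicit.
Unset Printing Implicit Defensive.

(* Differentiability of the batch losses near the minimum forces every
   pre-activation to be nonzero at every data point. Hence, near the minimum, each
   residual is a quadratic polynomial in the parameters, and since residuals vanish
   there the mean Hessian is the mean of the Gram matrices phi_j phi_j^T, with phi_j
   the gradient of the network at x_j. The expected distance dominates the norm of
   the mean trajectory (I - eta H)^t u, so stability gives u^T H u <= (2 / eta) |u|^2;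
   for u the mean of the phi_j, Jensen's inequality turns this into
   |u|^2 <= 2 / eta. On the other hand, AM-GM applied neuron by neuron gives
   |u|^2 >= 1 + 2 sum_i |w2_i| |w1_i| gtilde(w1_i / |w1_i|, - b1_i / |w1_i|).
   Finally a_p in the canonical representation is the sum of the w2_i |w1_i| over the
   neurons whose kink is the p-th hyperplane: compare second differences across a
   point of that hyperplane lying on no other kink. *)

(** * Euclidean inner product and norm on column vectors *)

Section EuclideanVectors.
Variables (R : realType) (m : nat).
Implicit Types u v w : 'cV[R]_m.

Lemma dotvC u v : dotv u v = dotv v u.
Proof. by apply: eq_bigr => i _; rewrite mulrC. Qed.

Lemma dotvDl u v w : dotv (u + v) w = dotv u w + dotv v w.
Proof. by rewrite -big_split; apply: eq_bigr => i _; rewrite !mxE mulrDl. Qed.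

Lemma dotvZl (c : R) u v : dotv (c *: u) v = c * dotv u v.
Proof. by rewrite mulr_sumr; apply: eq_bigr => i _; rewrite !mxE mulrA. Qed.

Lemma dotvDr u v w : dotv u (v + w) = dotv u v + dotv u w.
Proof. by rewrite dotvC dotvDl !(dotvC u). Qed.

Lemma dotvZr (c : R) u v : dotv u (c *: v) = c * dotv u v.
Proof. by rewrite dotvC dotvZl (dotvC u). Qed.

Lemma dotvNl u v : dotv (- u) v = - dotv u v.
Proof. by rewrite -scaleN1r dotvZl mulN1r. Qed.

Lemma dotvBl u v w : dotv (u - v) w = dotv u w - dotv v w.
Proof. by rewrite dotvDl dotvNl. Qed.

Lemma dotv0l v : dotv 0 v = 0.
Proof. by rewrite -(scale0r 0) dotvZl mul0r. Qed.

Lemma dotv_suml (I : Type) (r : seq I) (P : pred I) (F : I -> 'cV[R]_m) v :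
  dotv (\sum_(i <- r | P i) F i) v = \sum_(i <- r | P i) dotv (F i) v.
Proof.
by elim/big_rec2: _ => [|i _ w _ <-]; rewrite ?dotv0l // dotvDl.
Qed.

Lemma dotv_ge0 u : 0 <= dotv u u.
Proof. by apply: sumr_ge0 => i _; rewrite -expr2 sqr_ge0. Qed.

Lemma dotv_eq0 u : dotv u u = 0 -> u = 0.
Proof.
move=> /eqP; rewrite psumr_eq0 => [/allP h|i _]; last by rewrite -expr2 sqr_ge0.
apply/colP => i; rewrite mxE; apply/eqP.
by have := h i (mem_index_enum i); rewrite -expr2 sqrf_eq0.
Qed.

Lemma normv_ge0 u : 0 <= normv u.
Proof. exact: sqrtr_ge0. Qed.

Lemma sqr_normv u : normv u ^+ 2 = dotv u u.
Proof. by rewrite sqr_sqrtr // dotv_ge0. Qed.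

Lemma normv0 : normv (0 : 'cV[R]_m) = 0.
Proof. by rewrite /normv dotv0l sqrtr0. Qed.

Lemma normvZ (c : R) u : normv (c *: u) = `|c| * normv u.
Proof.
by rewrite /normv dotvZl dotvZr mulrA -expr2 sqrtrM ?sqr_ge0 // sqrtr_sqr.
Qed.

(** Cauchy-Schwarz: the squared norm of |v|^2 u - (u.v) v is |v|^2 times the gap, so only v = 0 is
    treated apart. *)
Lemma dotv_sqr_le u v : dotv u v ^+ 2 <= dotv u u * dotv v v.
Proof.
have := dotv_ge0 (dotv v v *: u - dotv u v *: v).
rewrite dotvBl !dotvZl !(dotvC _ (_ - _)) !dotvBl !dotvZl (dotvC v u).
have := dotv_ge0 v; rewrite le_eqVlt => /orP[/eqP /esym /dotv_eq0 ->|v0 h].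
  by move=> _; rewrite (dotvC u) !dotv0l expr0n mulr0 lexx.
by rewrite -(ler_pM2l v0) -subr_ge0; move: h; congr (_ <= _); ring.
Qed.

Lemma normr_dotv_le u v : `|dotv u v| <= normv u * normv v.
Proof.
rewrite -(ler_pXn2r (n := 2)) ?nnegrE ?mulr_ge0 ?normv_ge0 //.
by rewrite exprMn !sqr_normv real_normK ?num_real // dotv_sqr_le.
Qed.

Lemma normvD u v : normv (u + v) <= normv u + normv v.
Proof.
rewrite -(ler_pXn2r (n := 2)) ?nnegrE ?addr_ge0 ?normv_ge0 //.
rewrite sqr_normv dotvDl !dotvDr (dotvC v u) sqrrD !sqr_normv.
by have := le_trans (ler_norm _) (normr_dotv_le u v); lra.
Qed.

Lemma normv_sum (I : Type) (r : seq I) (P : pred I) (F : I -> 'cV[R]_m) :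
  normv (\sum_(i <- r | P i) F i) <= \sum_(i <- r | P i) normv (F i).
Proof.
elim/big_rec2: _ => [|i w s _ IH]; first by rewrite normv0.
by apply: le_trans (normvD _ _) _; rewrite lerD2l.
Qed.

End EuclideanVectors.

(** * Derivatives read off from polynomial restrictions to lines *)

Section Preliminaries.
Variable R : realType.

Lemma finite_pos_lower_bound (I : finType) (F : I -> R) :
  (forall i, 0 < F i) -> exists2 e : R, 0 < e & forall i, e <= F i.
Proof.
move=> F0; exists (\big[Num.min/1]_i F i).
  by elim/big_ind: _ => // a b a0 b0; rewrite lt_min a0.
by move=> i; rewrite (bigD1 i) //= ge_min lexx.
Qed.

Lemma horner_bounded (p : {poly R}) :
  exists2 C : R, 0 <= C & forall s, `|s| <= 1 -> `|p.[s]| <= C.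
Proof.
elim/poly_ind: p => [|p c [C C0 hC]].
  by exists 0 => // s _; rewrite horner0 normr0.
exists (C + `|c|) => [|s hs]; first by rewrite addr_ge0.
rewrite hornerMXaddC (le_trans (ler_normD _ _)) // lerD2r normrM.
by rewrite -[leRHS]mulr1 ler_pM ?hC.
Qed.

Lemma poly_first_order (p : {poly R}) :
  exists q : {poly R}, forall s, p.[s] = p`_0 + p`_1 * s + s ^+ 2 * q.[s].
Proof.
exists (drop_poly 2 p) => s; rewrite -{1}(poly_take_drop 2 p).
rewrite hornerD hornerM hornerXn [X in X.[s]]/take_poly horner_poly.
by rewrite !big_ord_recl big_ord0 /= expr0 expr1; ring.
Qed.

(** Divide the first order estimate by s and let s tend to 0. The factor [c] stands for the norm of
    a direction, which may be zero. *)
Lemma derivative_coef1 (p : {poly R}) (c D : R) : 0 <= c ->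
  (forall e, 0 < e -> exists2 rho, 0 < rho &
     forall s, `|s| < rho -> `|p.[s] - p.[0] - D * s| <= e * (c * `|s|)) ->
  D = p`_1.
Proof.
move=> c0 h; have [q hq] := poly_first_order p.
have [C C0 hC] := horner_bounded q.
apply/eqP; rewrite eq_sym -subr_eq0 -normr_le0; apply/ler_addgt0Pr => e e0.
rewrite add0r.
have [rho rho0 hr] := h (e / 2 / (c + 1)) ltac:(by rewrite !divr_gt0 ?ltr_wpDl).
(* The bound 1 makes [C] available for [q]; the last bound keeps the quadratic remainder, divided by
   s, below e / 2. The other half of e pays for the estimate [hr]. *)
pose s := Num.min (rho / 2) (Num.min 1 (e / 2 / (C + 1))).
have s0 : 0 < s by rewrite !lt_min ltr01 !divr_gt0 // ltr_wpDl.
have s1 : s <= rho / 2 by rewrite ge_min lexx.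
have s2 : s <= 1 by rewrite !ge_min lexx orbT.
have s3 : s <= e / 2 / (C + 1) by rewrite !ge_min lexx !orbT.
have ns : `|s| = s by rewrite gtr0_norm.
have := hr s ltac:(rewrite ns; lra).
rewrite !hq ns expr0n mulr0 mul0r !addr0.
have -> : p`_0 + p`_1 * s + s ^+ 2 * q.[s] - p`_0 - D * s
   = s * (p`_1 - D + s * q.[s]) by ring.
rewrite normrM ns [X in _ <= X]mulrA [X in _ <= X]mulrC ler_pM2l // => h1.
have aux (b : R) : 0 <= b -> e / 2 / (b + 1) * b <= e / 2.
  move=> b0; have b1 : 0 < b + 1 by rewrite ltr_wpDl.
  rewrite mulrAC ler_pdivrMr //; nra.
have h2 : `|s * q.[s]| <= e / 2.
  rewrite normrM ns (le_trans (ler_wpM2l (ltW s0) (hC _ _))) ?ns //.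
  by apply: le_trans (aux _ C0); rewrite ler_wpM2r.
have h3 := aux _ c0.
have -> : p`_1 - D = (p`_1 - D + s * q.[s]) - s * q.[s] by ring.
by rewrite (le_trans (ler_normB _ _)) //; lra.
Qed.

(** Gradients are thus computed by extracting a coefficient along a line, which replaces the rules
    of differentiation. *)
Lemma gradient_along_line m (F : 'cV[R]_m -> R) (th g e : 'cV[R]_m)
    (p : {poly R}) (delta : R) :
  has_gradient F th g -> 0 < delta ->
  (forall s, `|s| < delta -> F (th + s *: e) = p.[s]) -> dotv g e = p`_1.
Proof.
move=> hg d0 hp; apply: (@derivative_coef1 _ (normv e)) => [|eps eps0].
  exact: normv_ge0.
have [rho [rho0 hr]] := hg eps eps0.
have e0 : 0 < normv e + 1 by rewrite ltr_wpDl ?normv_ge0.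
exists (Num.min delta (rho / (normv e + 1))) => [|s].
  by rewrite lt_min d0 divr_gt0.
rewrite lt_min => /andP[s1 s2].
have := hr (s *: e); rewrite normvZ dotvZr hp //.
have := hp 0; rewrite normr0 scale0r addr0 => -> //.
rewrite (mulrC s) (mulrC (normv e)); apply.
move: s2; rewrite ltr_pdivlMr //; apply: le_lt_trans.
by rewrite ler_wpM2l // lerDl.
Qed.

Lemma jacobian_along_line m (G : 'cV[R]_m -> 'cV[R]_m) (th h e : 'cV[R]_m)
    (H : 'M[R]_m) (p : {poly R}) (delta : R) :
  has_jacobian G th H -> 0 < delta ->
  (forall t, `|t| < delta -> dotv (G (th + t *: h)) e = p.[t]) ->
  dotv (H *m h) e = p`_1.
Proof.
move=> hJ d0 hp; apply: (@derivative_coef1 _ (normv e * normv h)) => [|eps eps0].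
  by rewrite mulr_ge0 ?normv_ge0.
have [rho [rho0 hr]] := hJ eps eps0.
have h0 : 0 < normv h + 1 by rewrite ltr_wpDl ?normv_ge0.
exists (Num.min delta (rho / (normv h + 1))) => [|s].
  by rewrite lt_min d0 divr_gt0.
rewrite lt_min => /andP[s1 s2]; rewrite -hp //.
have := hp 0; rewrite normr0 scale0r addr0 => <- //.
rewrite (mulrC _ s) -dotvZl -!dotvBl scalemxAr.
rewrite (le_trans (normr_dotv_le _ _)) // -mulrA mulrCA mulrC.
rewrite ler_wpM2l ?normv_ge0 // (mulrC (normv h)) -normvZ; apply: hr.
rewrite normvZ; move: s2; rewrite ltr_pdivlMr //; apply: le_lt_trans.
by rewrite ler_wpM2l // lerDl.
Qed.

End Preliminaries.

(** * Parameter coordinates and the local quadratic expansion of the network *)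

Section NetworkExpansion.
Variables (R : realType) (d k : nat).
Implicit Types th u : 'cV[R]_(npar d k).

(** Totalises functions on ordinals, so that [mkpar] can index by quotients, remainders and
    differences without range proofs. *)
Definition ord_ext (T : Type) (m : nat) (x0 : T) (F : 'I_m -> T) (p : nat) : T :=
  oapp F x0 (insub p).

Definition mkpar (w1 : 'I_k -> 'I_d -> R) (b1 w2 : 'I_k -> R) (b2 : R) :
    'cV[R]_(npar d k) :=
  \col_p if (p < k * d)%N then
           ord_ext 0 (ord_ext (fun=> 0) w1 (p %/ d)) (p %% d)
         else if (p < k * d + k)%N then ord_ext 0 b1 (p - k * d)
         else if (p < k * d + k + k)%N then ord_ext 0 w2 (p - (k * d + k))
         else b2.

Lemma ord_extE (T : Type) (m : nat) (x0 : T) (F : 'I_m -> T) (i : 'I_m) :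
  ord_ext x0 F i = F i.
Proof. by rewrite /ord_ext valK. Qed.

Lemma par_w1_mkpar w1 b1 w2 b2 i l : par_w1 (mkpar w1 b1 w2 b2) i l = w1 i l.
Proof.
have hp : (i * d + l < k * d)%N by have := ltn_ord i; have := ltn_ord l; nia.
have d0 : (0 < d)%N by have := ltn_ord l; lia.
rewrite /par_w1 mxE inordK; last by rewrite /npar; lia.
by rewrite hp divnMDl // modnMDl divn_small // addn0 modn_small // !ord_extE.
Qed.

Lemma par_b1_mkpar w1 b1 w2 b2 i : par_b1 (mkpar w1 b1 w2 b2) i = b1 i.
Proof.
have hi := ltn_ord i; rewrite /par_b1 mxE inordK; last by rewrite /npar; lia.
rewrite ifF; last by lia.
by rewrite ifT ?addKn ?ord_extE //; lia.
Qed.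

Lemma par_w2_mkpar w1 b1 w2 b2 i : par_w2 (mkpar w1 b1 w2 b2) i = w2 i.
Proof.
have hi := ltn_ord i; rewrite /par_w2 mxE inordK; last by rewrite /npar; lia.
rewrite ifF; last by lia.
rewrite ifF; last by lia.
by rewrite ifT ?addKn ?ord_extE //; lia.
Qed.

Lemma par_b2_mkpar w1 b1 w2 b2 : par_b2 (mkpar w1 b1 w2 b2) = b2.
Proof.
rewrite /par_b2 mxE inordK; last by rewrite /npar; lia.
rewrite ifF; last by lia.
rewrite ifF; last by lia.
by rewrite ifF //; lia.
Qed.

Lemma big_nat_block (F : nat -> R) (a b : nat) :
  \sum_(0 <= p < a * b) F p = \sum_(i < a) \sum_(l < b) F (i * b + l)%N.
Proof.
elim: a => [|a IH]; first by rewrite mul0n big_geq // big_ord0.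
rewrite big_ord_recr /= -IH (@big_cat_nat _ _ _ (a * b)%N) //=; last by lia.
congr (_ + _); rewrite -{1}[(a * b)%N]add0n big_addn big_mkord.
have -> : (a.+1 * b - a * b)%N = b by lia.
by apply: eq_bigr => l _; rewrite addnC.
Qed.

Lemma dotv_par th u : dotv th u =
  \sum_(i < k) (\sum_(l < d) par_w1 th i l * par_w1 u i l
     + par_b1 th i * par_b1 u i + par_w2 th i * par_w2 u i)
  + par_b2 th * par_b2 u.
Proof.
pose F p := th (inord p) 0 * u (inord p) 0.
have -> : dotv th u = \sum_(0 <= p < npar d k) F p.
  by rewrite big_mkord; apply: eq_bigr => p _; rewrite /F inord_val.
have -> : npar d k = (k * d + k + k).+1 by rewrite /npar; lia.
rewrite big_nat_recr //= (@big_cat_nat _ _ _ (k * d + k)%N) //=; last by lia.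
rewrite (@big_cat_nat _ _ _ (k * d)%N _ (k * d + k)%N) //=; last by lia.
have shift m : \sum_(m <= p < m + k) F p = \sum_(i < k) F (m + i)%N.
  rewrite -{1}[m]add0n big_addn addKn big_mkord.
  by apply: eq_bigr => i _; rewrite addnC.
by rewrite big_nat_block !shift -!big_split.
Qed.

Definition preact th (i : 'I_k) (z : 'cV[R]_d) : R :=
  \sum_(l < d) z l 0 * par_w1 th i l + par_b1 th i.

(** The derivative of [relu] at the pre-activation, with value 0 at the kink. *)
Definition gate th (i : 'I_k) (z : 'cV[R]_d) : R := (0 < preact th i z)%R%:R.

Lemma netE th z :
  net th z = \sum_(i < k) par_w2 th i * relu (preact th i z) + par_b2 th.
Proof. by []. Qed.

Lemma par_w1D th u i l : par_w1 (th + u) i l = par_w1 th i l + par_w1 u i l.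
Proof. exact: mxE. Qed.
Lemma par_b1D th u i : par_b1 (th + u) i = par_b1 th i + par_b1 u i.
Proof. exact: mxE. Qed.
Lemma par_w2D th u i : par_w2 (th + u) i = par_w2 th i + par_w2 u i.
Proof. exact: mxE. Qed.
Lemma par_b2D th u : par_b2 (th + u) = par_b2 th + par_b2 u.
Proof. exact: mxE. Qed.
Lemma par_w1Z (c : R) u i l : par_w1 (c *: u) i l = c * par_w1 u i l.
Proof. exact: mxE. Qed.
Lemma par_b1Z (c : R) u i : par_b1 (c *: u) i = c * par_b1 u i.
Proof. exact: mxE. Qed.
Lemma par_w2Z (c : R) u i : par_w2 (c *: u) i = c * par_w2 u i.
Proof. exact: mxE. Qed.
Lemma par_b2Z (c : R) u : par_b2 (c *: u) = c * par_b2 u.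
Proof. exact: mxE. Qed.

Lemma preactD th u i z : preact (th + u) i z = preact th i z + preact u i z.
Proof.
rewrite /preact par_b1D addrACA -big_split; congr (_ + _).
by apply: eq_bigr => l _; rewrite par_w1D mulrDr.
Qed.

Lemma preactZ (c : R) u i z : preact (c *: u) i z = c * preact u i z.
Proof.
rewrite /preact par_b1Z mulrDr mulr_sumr; congr (_ + _).
by apply: eq_bigr => l _; rewrite par_w1Z mulrCA.
Qed.

Lemma relu_ge0 (t : R) : 0 <= relu t.
Proof. by rewrite /relu le_max lexx orbT. Qed.

Lemma reluE (t : R) : relu t = (0 < t)%R%:R * t.
Proof. by rewrite /relu; case: ltrP => _; rewrite ?mul1r ?mul0r. Qed.

Lemma relu_near (s t : R) : `|t| < `|s| -> relu (s + t) = (0 < s)%R%:R * (s + t).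
Proof.
rewrite reluE => h; congr ((nat_of_bool _)%:R * _); move: h.
by case: (ltrP 0 s) => s0; case: (ltrP 0 (s + t)) => st0; case: (ger0P t) => t0 //;
  rewrite ?(gtr0_norm s0) ?(ler0_norm s0) => h; exfalso; lra.
Qed.

(* First and second order parts of [net] at [th] for the activation pattern of
   [th]: with frozen gates the network is a quadratic polynomial in [th]. *)
Definition net_lin th (z : 'cV[R]_d) u : R :=
  \sum_(i < k) gate th i z * (par_w2 u i * preact th i z + par_w2 th i * preact u i z)
  + par_b2 u.

Definition net_quad th (z : 'cV[R]_d) u u' : R :=
  \sum_(i < k) gate th i z * (par_w2 u i * preact u' i z).

(** Exact, without remainder: no pre-activation changes sign, and an open neuron is the product of
    its output weight and its pre-activation, both affine in the parameters. *)
Lemma net_expand th z u :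
  (forall i, `|preact u i z| < `|preact th i z|) ->
  net (th + u) z = net th z + net_lin th z u + net_quad th z u u.
Proof.
move=> h; rewrite !netE par_b2D /net_lin /net_quad.
rewrite [LHS](_ : _ = \sum_(i < k) (par_w2 th i * relu (preact th i z)
  + gate th i z * (par_w2 u i * preact th i z + par_w2 th i * preact u i z)
  + gate th i z * (par_w2 u i * preact u i z)) + (par_b2 th + par_b2 u)).
  by rewrite !big_split /=; ring.
congr (_ + _); apply: eq_bigr => i _.
by rewrite preactD relu_near // reluE par_w2D /gate; ring.
Qed.

Lemma net_linD th z u u' : net_lin th z (u + u') = net_lin th z u + net_lin th z u'.
Proof.
rewrite /net_lin par_b2D addrACA -big_split; congr (_ + _).
by apply: eq_bigr => i _; rewrite par_w2D preactD /=; ring.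
Qed.

Lemma net_linZ th z (c : R) u : net_lin th z (c *: u) = c * net_lin th z u.
Proof.
rewrite /net_lin par_b2Z mulrDr mulr_sumr; congr (_ + _).
by apply: eq_bigr => i _; rewrite par_w2Z preactZ; ring.
Qed.

Lemma net_quad_line th z (s t : R) u u' :
  net_quad th z (s *: u + t *: u') (s *: u + t *: u') =
  s ^+ 2 * net_quad th z u u + s * t * (net_quad th z u u' + net_quad th z u' u)
  + t ^+ 2 * net_quad th z u' u'.
Proof.
rewrite /net_quad -big_split !mulr_sumr -!big_split.
by apply: eq_bigr => i _; rewrite par_w2D preactD !par_w2Z !preactZ /=; ring.
Qed.

End NetworkExpansion.

(** * Smoothness and Hessian of a batch loss at an interpolating point *)

Section LossDerivatives.
Variables (R : realType) (d k n B : nat).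
Variables (x : 'I_n -> 'cV[R]_d) (y : 'I_n -> R) (S : {set 'I_n}).
Variables (th : 'cV[R]_(npar d k)) (G : 'cV[R]_(npar d k) -> 'cV[R]_(npar d k)).
Variable (H : 'M[R]_(npar d k)).
Hypothesis B_gt0 : (0 < B)%N.
Hypothesis interp : forall j, net th (x j) = y j.
Hypothesis diff2 : twice_diff_at (batch_loss B x y S) th G H.

Lemma relu_second_diff_ge0 (s t : R) : 0 <= relu (s + t) + relu (s - t) - 2 * relu s.
Proof.
rewrite !reluE.
by case: (ltrP 0 s); case: (ltrP 0 (s + t)); case: (ltrP 0 (s - t)) => /=; lra.
Qed.

Lemma preact_mkpar0 (b1 w2 : 'I_k -> R) (b2 : R) i (z : 'cV[R]_d) :
  preact (mkpar (fun _ _ => 0) b1 w2 b2) i z = b1 i.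
Proof.
rewrite /preact par_b1_mkpar big1 ?add0r // => l _.
by rewrite par_w1_mkpar mulr0.
Qed.

(** A change of output weight and output bias moves the residuals while leaving every
    pre-activation, hence every kink, in place. *)
Lemma net_shift_output (i : 'I_k) (al be : R) z :
  let u := mkpar (fun _ _ => 0) (fun=> 0) (fun i' => (i' == i)%:R * be) al in
  net (th + u) z = net th z + be * relu (preact th i z) + al.
Proof.
rewrite /= !netE par_b2D par_b2_mkpar addrA; congr (_ + _).
rewrite addrAC; congr (_ + _).
rewrite (bigD1 i) //= [in RHS](bigD1 i) //= par_w2D par_w2_mkpar eqxx.
have pre0 i' : preact (th + mkpar (fun _ _ => 0) (fun=> 0)
    (fun i' => (i' == i)%:R * be) al) i' z = preact th i' z.
  by rewrite preactD preact_mkpar0 addr0.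
rewrite pre0 addrAC mul1r mulrDl; congr (_ + _).
by apply: eq_bigr => i' /negPf ne; rewrite pre0 par_w2D par_w2_mkpar ne mul0r addr0.
Qed.

Lemma net_shift_bias (th' : 'cV[R]_(npar d k)) (i : 'I_k) (t : R) z :
  let e := mkpar (fun _ _ => 0) (fun i' => (i' == i)%:R) (fun=> 0) 0 in
  net (th' + t *: e) z = net th' z
    + par_w2 th' i * (relu (preact th' i z + t) - relu (preact th' i z)).
Proof.
rewrite /= !netE par_b2D par_b2Z par_b2_mkpar mulr0 addr0.
rewrite (bigD1 i) //= [in RHS](bigD1 i) //=.
have pre0 i' : preact (th' + t *: mkpar (fun _ _ => 0) (fun i' => (i' == i)%:R)
    (fun=> 0) 0) i' z = preact th' i' z + t * (i' == i)%:R.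
  by rewrite preactD preactZ preact_mkpar0.
rewrite pre0 par_w2D par_w2Z par_w2_mkpar eqxx mulr0 mulr1 addr0.
set A := \sum_(_ | _) _; set A' := \sum_(_ | _) _.
have -> : A = A' by apply: eq_bigr => i' /negPf ne;
  rewrite pre0 par_w2D par_w2Z par_w2_mkpar ne !mulr0 !addr0.
by ring.
Qed.

(* Moving the outputs off the data by a small [c] makes the loss first order
   sensitive to the kink of neuron [i]; the second difference in the bias of
   that neuron is then of order [t] instead of [o(t)]. *)
Lemma preact_neq0 (i : 'I_k) (j : 'I_n) : j \in S -> preact th i (x j) != 0.
Proof.
move=> jS; apply/negP => /eqP pre0.
have [[delta [delta0 hG]] _] := diff2.
(* With this sign the shift [U c] makes residual times output weight equal to [ka * (relu + 1)],
   positive at every data point even if the original weight is zero. The summand 1 comes from the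
   output bias and survives at [x j], where [relu] vanishes. *)
pose sg : R := if 0 <= par_w2 th i then 1 else -1.
have sg2 : sg * sg = 1 by rewrite /sg; case: ifP => _; ring.
have sgw : sg * par_w2 th i = `|par_w2 th i|.
  by rewrite /sg; case: ger0P => h; ring.
pose U (c : R) := mkpar (fun (_ : 'I_k) (_ : 'I_d) => 0 : R) (fun=> 0)
   (fun i' => (i' == i)%:R * (sg * c)) (sg * c).
have U1 : 0 < normv (U 1) + 1 by rewrite ltr_wpDl ?normv_ge0.
pose c := delta / 2 / (normv (U 1) + 1).
have c0 : 0 < c by rewrite !divr_gt0.
have UZ : U c = c *: U 1.
  apply/colP => p; rewrite !mxE; do 3 ?[case: ifP => _]; rewrite /ord_ext.
  - by case: insub => [i'|] /=; case: insub => [l|] /=; rewrite ?mulr0.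
  - by case: insub => [l|] /=; rewrite ?mulr0.
  - by case: insub => [l|] /=; rewrite ?mulr0 //; ring.
  by ring.
pose th' := th + U c.
have /hG : normv (th' - th) < delta.
  rewrite /th' addrC addKr UZ normvZ gtr0_norm // /c mulrAC ltr_pdivrMr //.
  by have := normv_ge0 (U 1); nra.
set F := batch_loss B x y S; set g := G th' => hg.
pose e := mkpar (fun (_ : 'I_k) (_ : 'I_d) => 0 : R) (fun i' => (i' == i)%:R)
   (fun=> 0) 0.
pose w := par_w2 th' i.
have wE : w = par_w2 th i + sg * c.
  by rewrite /w /th' /U par_w2D par_w2_mkpar eqxx mul1r.
have pre' z : preact th' i z = preact th i z.
  by rewrite preactD preact_mkpar0 addr0.
pose ka := c * (`|par_w2 th i| + c).
have ka0 : 0 < ka by rewrite mulr_gt0 // ltr_wpDl.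
pose r j' := net th' (x j') - y j'.
have rE j' : r j' = sg * c * (relu (preact th i (x j')) + 1).
  by rewrite /r /th' /U net_shift_output interp; ring.
have rw j' : r j' * w = ka * (relu (preact th i (x j')) + 1).
  rewrite rE wE.
  transitivity (c * (sg * par_w2 th i + sg * sg * c)
    * (relu (preact th i (x j')) + 1)); first by ring.
  by rewrite sg2 mul1r sgw.
have B0 : 0 < B%:R :> R by rewrite ltr0n.
(* Each loss term dominates [ka] times the second difference of [relu], which is nonnegative by
   convexity and equals t at the data point on the kink. *)
have second t : 0 <= t -> ka * t / B%:R <=
    F (th' + t *: e) + F (th' + (- t) *: e) - 2 * F th'.
  move=> t0; rewrite /F /batch_loss [2 * _]mulrA -mulrDl -mulrBl ler_pM2r ?invr_gt0 //.
  rewrite mulr_sumr -big_split -sumrB /=.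
  have term j' : ka * (relu (preact th i (x j') + t) + relu (preact th i (x j') - t)
      - 2 * relu (preact th i (x j'))) <= loss_j x y j' (th' + t *: e)
      + loss_j x y j' (th' + (- t) *: e) - 2 * loss_j x y j' th'.
    rewrite /loss_j !net_shift_bias -/w !pre' -/(r j').
    rewrite ![net th' _ + _ - _]addrAC -/(r j').
    have := relu_second_diff_ge0 (preact th i (x j')) t; have := rw j'.
    have := relu_ge0 (preact th i (x j')).
    move: (relu (_ + t)) (relu (_ - t)) (relu (preact _ _ _)) (r j') => a b c' r'.
    move=> c'0 rwE ab; have : 0 <= (r' * w - ka) * (a + b - 2 * c').
      by rewrite mulr_ge0 // rwE; nra.
    have := sqr_ge0 (w * (a - c')); have := sqr_ge0 (w * (b - c')); nra.
  rewrite (bigD1 j) //= -[leLHS]addr0 lerD //.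
    apply: le_trans (term j); rewrite pre0 add0r sub0r /relu.
    by rewrite max_l // max_r ?max_l //; lra.
  apply: sumr_ge0 => j' _; apply: le_trans (term j').
  by rewrite mulr_ge0 ?(ltW ka0) ?relu_second_diff_ge0.
have e0 := normv_ge0 e.
(* Differentiability at [th'] then bounds the second difference by half of its lower bound: two
   errors, each at most a quarter. *)
pose eps := ka / B%:R / 4 / (normv e + 1).
have eps0 : 0 < eps by rewrite !divr_gt0 ?ltr_wpDl.
have [rho [rho0 hr]] := hg eps eps0.
pose t := rho / 2 / (normv e + 1).
have t0 : 0 < t by rewrite !divr_gt0 ?ltr_wpDl.
have te : t * normv e < rho.
  by rewrite /t mulrAC ltr_pdivrMr ?ltr_wpDl //; nra.
have := hr (t *: e); rewrite normvZ gtr0_norm // dotvZr => /(_ te).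
have := hr (- t *: e); rewrite normvZ normrN gtr0_norm // dotvZr => /(_ te).
have := second t (ltW t0).
have : eps * normv e <= ka / B%:R / 4.
  by rewrite /eps mulrAC ler_pdivrMr ?ltr_wpDl // ler_wpM2l ?lerDl // !divr_ge0 // ltW.
have : 0 < ka / B%:R by rewrite divr_gt0.
rewrite [ka * t / _]mulrAC !ler_norml; move: (ka / B%:R) => K K0 he h2 /andP[_ h3] /andP[_ h4].
have : eps * (t * normv e) <= K / 4 * t.
  by rewrite mulrCA [leLHS]mulrC ler_wpM2r ?(ltW t0).
by nra.
Qed.

Lemma coef1_sqr_quadratic (a b c : R) :
  ((a%:P + b%:P * 'X + c%:P * 'X^2) ^+ 2)`_1 = 2 * (a * b).
Proof.
rewrite expr2 coefM !big_ord_recl big_ord0 /= !coefE /=; ring.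
Qed.

Hypothesis smooth : forall i j, preact th i (x j) != 0.

(** Since [th] interpolates, the residual at th + t h + s e is a polynomial in t and s without
    constant term. In the s t coefficient of its square only products of linear parts remain, so the
    Gauss-Newton form is exact. *)
Lemma hessian_form (h e : 'cV[R]_(npar d k)) :
  G th = 0 /\
  dotv (H *m h) e =
    (\sum_(j in S) net_lin th (x j) h * net_lin th (x j) e) / B%:R.
Proof.
pose L j := net_lin th (x j).
pose Q j := net_quad th (x j).
suff key (h' e' : 'cV[R]_(npar d k)) : exists2 delta : R, 0 < delta &
    forall t, `|t| < delta -> dotv (G (th + t *: h')) e' =
    (\sum_(j in S) (t * L j h' + t ^+ 2 * Q j h' h')
        * (L j e' + t * (Q j h' e' + Q j e' h'))) / B%:R.
  split.
    (* At t = 0 the formula, tested against [G th] itself, says that its squared norm is zero. *)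
    apply: dotv_eq0; have [delta delta0 /(_ 0)] := key 0 (G th).
    rewrite normr0 scale0r addr0 => -> //.
    by rewrite big1 ?mul0r // => j _; ring.
  have [delta delta0 hd] := key h e.
  pose p := B%:R^-1 *: \sum_(j in S) ('X * (L j h)%:P + 'X^2 * (Q j h h)%:P)
     * ((L j e)%:P + 'X * (Q j h e + Q j e h)%:P).
  rewrite (@jacobian_along_line _ _ G th h e H p delta) //; last first.
    move=> t /hd ->; rewrite /p hornerZ horner_sum mulrC; congr (_ * _).
    by apply: eq_bigr => j _; rewrite !hornerE.
    by case: diff2.
  rewrite /p coefZ coef_sum mulrC; congr (_ * _).
  apply: eq_bigr => j _; rewrite coefM !big_ord_recl big_ord0 /= !coefE /=.
  by rewrite /L; ring.
have [[dG [dG0 hG]] _] := diff2.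
(* For |t| and |s| below this radius, t h' + s e' switches no gate at any data point. *)
have [rho rho0 hrho] := @finite_pos_lower_bound R ('I_k * 'I_n)%type
  (fun ij => `|preact th ij.1 (x ij.2)|
     / (1 + `|preact h' ij.1 (x ij.2)| + `|preact e' ij.1 (x ij.2)|))
  ltac:(by move=> ij; rewrite divr_gt0 ?normr_gt0 ?smooth // -addrA ltr_pwDl ?addr_ge0).
exists (Num.min rho (dG / (normv h' + 1))).
  by rewrite lt_min rho0 divr_gt0 // ltr_wpDl ?normv_ge0.
move=> t; rewrite lt_min => /andP[t1 t2].
have /hG hg : normv (th + t *: h' - th) < dG.
  rewrite addrC addKr normvZ.
  move: t2; rewrite ltr_pdivlMr ?ltr_wpDl ?normv_ge0 //; apply: le_lt_trans.
  by rewrite ler_wpM2l // lerDl.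
pose P j : {poly R} := (t * L j h' + t ^+ 2 * Q j h' h')%:P
  + (L j e' + t * (Q j h' e' + Q j e' h'))%:P * 'X + (Q j e' e')%:P * 'X^2.
pose p := (B%:R^-1 / 2) *: \sum_(j in S) P j ^+ 2.
rewrite (gradient_along_line hg rho0 (p := p)).
  rewrite /p coefZ coef_sum -mulrA mulrC mulr_sumr; congr (_ * _).
  by apply: eq_bigr => j _; rewrite coef1_sqr_quadratic mulKf ?pnatr_eq0.
move=> s s1; rewrite /batch_loss /p hornerZ horner_sum -mulrA [RHS]mulrC mulr_sumr.
congr (_ * _); apply: eq_bigr => j _; rewrite /loss_j mulrC.
congr (_ * _); rewrite horner_exp; congr (_ ^+ 2).
rewrite -[th + _ + _]addrA net_expand => [|i].
  by rewrite interp net_linD !net_linZ net_quad_line /P !hornerE /= /L /Q; ring.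
rewrite preactD !preactZ; have := hrho (i, j) => /=.
rewrite ler_pdivlMr; last by rewrite -addrA ltr_pwDl ?addr_ge0.
apply: lt_le_trans; apply: le_lt_trans (ler_normD _ _) _; rewrite !normrM.
have := normr_ge0 (preact h' i (x j)); have := normr_ge0 (preact e' i (x j)).
by nra.
Qed.

End LossDerivatives.

(** * Counting batches of fixed size *)

Section Batches.
Variables (R : realType) (n B : nat).
Hypotheses (B_gt0 : (0 < B)%N) (B_le_n : (B <= n)%N).

Lemma batch_through (j : 'I_n) : exists2 S : {set 'I_n}, is_batch B S & j \in S.
Proof.
have hB : (B.-1 <= #|[set~ j]|)%N by rewrite cardsC1 card_ord; lia.
have [A /subsetP sA cA] : exists2 A : {set 'I_n}, A \subset [set~ j] & #|A| = B.-1.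
  have : (0 < #|[set A : {set 'I_n} | A \subset [set~ j] & #|A| == B.-1]|)%N.
    by rewrite cards_draws bin_gt0.
  by case/card_gt0P => A; rewrite inE => /andP[? /eqP]; exists A.
exists (j |: A); last by rewrite !inE eqxx.
have /negPf jA : j \notin A by apply/negP => /sA; rewrite !inE eqxx.
by rewrite /is_batch cardsU1 jA cA; apply/eqP; rewrite /= add1n prednK.
Qed.

Hypothesis n_gt0 : (0 < n)%N.

Lemma nbatches_gt0 : (0 < nbatches n B)%N.
Proof.
have [S hS _] := batch_through (Ordinal n_gt0).
by apply/card_gt0P; exists S; rewrite inE.
Qed.

(** Transpositions permute the batches, so all indices lie in equally many of them; double counting
    gives that number. *)
Lemma sum_batches (F : 'I_n -> R) :
  \sum_(S : {set 'I_n} | is_batch B S) \sum_(j in S) F j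
  = (nbatches n B)%:R * B%:R / n%:R * \sum_j F j.
Proof.
pose c j := \sum_(S : {set 'I_n} | is_batch B S && (j \in S)) (1 : R).
have sumc (E : 'I_n -> R) :
    \sum_(S : {set 'I_n} | is_batch B S) \sum_(j in S) E j = \sum_j c j * E j.
  rewrite (exchange_big_dep predT) //=; apply: eq_bigr => j _.
  by rewrite mulr_suml; apply: eq_bigr => S _; rewrite mul1r.
have cE j j' : c j = c j'.
  have inv : involutive (fun S : {set 'I_n} => tperm j j' @: S).
    by move=> S; rewrite -imset_comp (eq_imset _ (tpermK j j')) imset_id.
  rewrite /c (reindex_inj (inv_inj inv)); apply: eq_bigl => S.
  rewrite /is_batch card_imset; last exact: perm_inj.
  by congr (_ && _); rewrite -{1}(tpermR j j') mem_imset //; apply: perm_inj.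
pose j0 := Ordinal n_gt0.
have total : n%:R * c j0 = (nbatches n B)%:R * B%:R.
  transitivity (\sum_(S : {set 'I_n} | is_batch B S) \sum_(j in S) (1 : R)).
    rewrite sumc (eq_bigr (fun=> c j0)) => [|j _]; last by rewrite mulr1 (cE j j0).
    by rewrite sumr_const card_ord mulr_natl.
  rewrite (eq_bigr (fun=> B%:R)) => [|S /eqP hS]; last by rewrite sumr_const hS.
  rewrite sumr_const mulr_natl; congr (_ *+ _).
  by apply: eq_card => S; rewrite inE.
rewrite sumc -total [n%:R * _]mulrC mulfK ?pnatr_eq0 -?lt0n // mulr_sumr.
by apply: eq_bigr => j _; rewrite (cE j j0).
Qed.

End Batches.

(** * The mean trajectory of the linearized dynamics *)

Section LinearizedDynamics.
Variables (R : realType) (p n B : nat) (eta : R) (thstar : 'cV[R]_p).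
Variables (gS : {set 'I_n} -> 'cV[R]_p) (HS : {set 'I_n} -> 'M[R]_p).
Hypothesis gS0 : forall S, is_batch B S -> gS S = 0.
Hypothesis batches : (0 < nbatches n B)%N.

Lemma sum_tuple_cons (V : zmodType) (T : finType) t (P : pred (seq T))
    (F : seq T -> V) :
  \sum_(s : t.+1.-tuple T | P s) F s
  = \sum_(a : T) \sum_(s : t.-tuple T | P (a :: s)) F (a :: s).
Proof.
rewrite pair_big_dep /=.
rewrite (reindex (fun q : T * t.-tuple T => [tuple of q.1 :: q.2])) //=.
exists (fun s : t.+1.-tuple T => (thead s, [tuple of behead s])) => [[a s] _|s _].
  by congr (_, _); apply: val_inj.
by rewrite -tuple_eta.
Qed.

Definition mean_hessian : 'M[R]_p :=
  (nbatches n B)%:R^-1 *: \sum_(S | is_batch B S) HS S.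

Definition mean_step : 'M[R]_p := 1%:M - eta *: mean_hessian.

(** Batch gradients vanish at [thstar], so each step is linear in the displacement; summing over the
    first batch and inducting on the others replaces every step by [mean_step], up to the number of
    batches. *)
Lemma sum_traj t (u : 'cV[R]_p) :
  \sum_(s : t.-tuple {set 'I_n} | all (is_batch B) s)
     (lin_traj eta thstar gS HS (thstar + u) s - thstar)
  = (nbatches n B)%:R ^+ t *: iter t (mulmx mean_step) u.
Proof.
elim: t u => [|t IH] u.
  rewrite (big_pred1 [tuple]) => [|s]; last by rewrite (tuple0 s) /= eq_refl.
  by rewrite /= scale1r addrC addKr.
rewrite (sum_tuple_cons _ (all (is_batch B)) (fun s =>
  lin_traj eta thstar gS HS (thstar + u) s - thstar)) (bigID (is_batch B)) /=.
rewrite [X in _ + X]big1 ?addr0; last first.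
  by move=> S /negPf hS; rewrite big1 // => s; rewrite hS.
transitivity (\sum_(S | is_batch B S)
   (nbatches n B)%:R ^+ t *: iter t (mulmx mean_step) (u - eta *: (HS S *m u))).
  apply: eq_bigr => S hS; rewrite -IH hS /=; apply: eq_bigr => s _.
  by rewrite /lin_step gS0 // add0r [thstar + u - thstar]addrC addKr addrA.
have iterD (a b : 'cV[R]_p) : iter t (mulmx mean_step) (a + b)
    = iter t (mulmx mean_step) a + iter t (mulmx mean_step) b.
  by elim: (t) => //= t' ->; rewrite mulmxDr.
have iter0 : iter t (mulmx mean_step) 0 = (0 : 'cV[R]_p).
  by elim: (t) => //= t' ->; rewrite mulmx0.
have iterZ (c : R) (a : 'cV[R]_p) : iter t (mulmx mean_step) (c *: a)
    = c *: iter t (mulmx mean_step) a.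
  by elim: (t) => //= t' ->; rewrite scalemxAr.
rewrite -scaler_sumr.
rewrite -(big_morph _ iterD iter0) exprSr -scalerA; congr (_ *: _).
rewrite -[mean_step *m _]/(iter t.+1 (mulmx mean_step) u) iterSr -iterZ; congr (iter _ _ _).
have N0 : (nbatches n B)%:R != 0 :> R by rewrite pnatr_eq0 -lt0n.
rewrite /mean_step /mean_hessian mulmxBl mul1mx scalerBr -!scalemxAl.
rewrite [X in _ - X]scalerA (mulrC _ eta) -scalerA [X in _ - eta *: X]scalerA mulfV //.
rewrite scale1r mulmx_suml scaler_sumr sumrB; congr (_ - _).
rewrite sumr_const scaler_nat; congr (_ *+ _).
by apply: eq_card => S; rewrite inE.
Qed.

Lemma exp_dist_ge t (u : 'cV[R]_p) :
  normv (iter t (mulmx mean_step) u) <= exp_dist B eta thstar gS HS (thstar + u) t.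
Proof.
have N0 : 0 < (nbatches n B)%:R ^+ t :> R by rewrite exprn_gt0 ?ltr0n.
rewrite /exp_dist ler_pdivlMr // mulrC -[X in X * _](gtr0_norm N0) -normvZ -sum_traj.
exact: normv_sum.
Qed.

End LinearizedDynamics.

(* For symmetric [M] the norms [|M^t u|] are log-convex, hence convex, in [t], so
   they grow at least linearly as soon as the first step expands. *)
Lemma symmetric_bounded_nonexpansive (R : realType) p (M : 'M[R]_p) (u : 'cV[R]_p)
    (C : R) (T : nat) :
  (forall a b, dotv (M *m a) b = dotv a (M *m b)) ->
  (forall t, (T <= t)%N -> normv (iter t (mulmx M) u) <= C) ->
  normv (M *m u) <= normv u.
Proof.
move=> symM bnd; rewrite leNgt; apply/negP => expd.
pose a t := normv (iter t (mulmx M) u).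
have a0 t : 0 <= a t by apply: normv_ge0.
(* Symmetry gives |M^(t+1) u|^2 = M^t u . M^(t+2) u; Cauchy-Schwarz and then AM-GM follow. *)
have convex t : a t.+1 - a t <= a t.+2 - a t.+1.
  have : a t.+1 ^+ 2 <= a t * a t.+2.
    rewrite /a sqr_normv /= symM; apply: le_trans (ler_norm _) _.
    exact: normr_dotv_le.
  have := sqr_ge0 (a t - a t.+2); have := a0 t; have := a0 t.+1; have := a0 t.+2.
  move: (a t) (a t.+1) (a t.+2) => A B C0 C00 B0 A0 h1 h2.
  suff : (2 * B) <= A + C0 by lra.
  by rewrite -(ler_pXn2r (n := 2)) ?nnegrE ?mulr_ge0 ?addr_ge0 //; nra.
have incr t : a 1%N - a 0%N <= a t.+1 - a t.
  by elim: t => // t IH; apply: le_trans IH (convex t).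
have lin t : a 0%N + t%:R * (a 1%N - a 0%N) <= a t.
  elim: t => [|t IH]; first by rewrite mul0r addr0.
  by rewrite -natr1 mulrDl mul1r; have := incr t; lra.
have ex0 : 0 < a 1%N - a 0%N by rewrite subr_gt0.
pose t := (T + Num.bound (`|C| / (a 1%N - a 0%N)))%N.
have : C < a t.
  apply: lt_le_trans (lin t); apply: le_lt_trans (ler_norm C) _.
  apply: lt_le_trans (_ : t%:R * (a 1%N - a 0%N) <= _); last by rewrite lerDr.
  rewrite -ltr_pdivrMr //.
  apply: lt_le_trans (archi_boundP _) _; first by rewrite divr_ge0 // ltW.
  by rewrite ler_nat leq_addl.
by rewrite ltNge bnd // leq_addr.
Qed.

(** * From linear stability to a bound on the mean gradient form *)

Section Stability.
Variables (R : realType) (d n k B : nat).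
Variables (x : 'I_n -> 'cV[R]_d) (y : 'I_n -> R) (eta : R).
Variable th : 'cV[R]_(npar d k).
Hypotheses (n_gt0 : (0 < n)%N) (B_gt0 : (0 < B)%N) (B_le_n : (B <= n)%N).
Hypothesis eta_gt0 : 0 < eta.
Hypothesis interp : forall j, net th (x j) = y j.
Hypothesis stable : lin_stable B x y eta th.

Lemma stable_preact_neq0 i j : preact th i (x j) != 0.
Proof.
have [eps [_ [_ [GS [HS [hd _]]]]]] := stable.
have [S bS jS] := batch_through B_gt0 B_le_n j.
exact: preact_neq0 B_gt0 interp (hd S bS) _ _ jS.
Qed.

Lemma stable_mean_gradient_le (u : 'cV[R]_(npar d k)) :
  ((\sum_j net_lin th (x j) u) / n%:R) ^+ 2 <= 2 / eta * dotv u u.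
Proof.
have [eps [eps0 [_ [GS [HS [hd hs]]]]]] := stable.
have N0 := nbatches_gt0 B_gt0 B_le_n n_gt0.
have hf S (bS : is_batch B S) := hessian_form interp (hd S bS) stable_preact_neq0.
set M := mean_step B eta HS; set Hm := mean_hessian B HS.
have nR : n%:R != 0 :> R by rewrite pnatr_eq0 -lt0n.
(* The batch counts cancel, leaving the mean of the Gram matrices over the whole data set. *)
have HmE a b : dotv (Hm *m a) b =
    (\sum_j net_lin th (x j) a * net_lin th (x j) b) / n%:R.
  rewrite /Hm /mean_hessian -scalemxAl mulmx_suml dotvZl dotv_suml.
  rewrite (eq_bigr (fun S : {set 'I_n} => (\sum_(j in S) net_lin th (x j) a * net_lin th (x j) b)
    / B%:R)) => [|S bS]; last by case: (hf S bS a b).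
  rewrite -mulr_suml sum_batches //.
  have BR : B%:R != 0 :> R by rewrite pnatr_eq0 -lt0n.
  have NR : (nbatches n B)%:R != 0 :> R by rewrite pnatr_eq0 -lt0n.
  by field; rewrite nR BR NR.
have symM a b : dotv (M *m a) b = dotv a (M *m b).
  rewrite /M /mean_step -/Hm !mulmxBl !mul1mx dotvBl [RHS]dotvC dotvBl (dotvC b a).
  rewrite -!(scalemxAl eta) !dotvZl !HmE; congr (_ - _ * (_ / _)).
  by apply: eq_bigr => j _; rewrite mulrC.
have nonexp : normv (M *m u) <= normv u.
  have nu : 0 < normv u + 1 by rewrite ltr_wpDl ?normv_ge0.
  (* Rescales [u] into the [eps] ball where stability applies; the claim is homogeneous in [u]. *)
  pose c := eps / (normv u + 1).
  have c0 : 0 < c by rewrite divr_gt0.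
  rewrite -(ler_pM2l c0) -[X in X * _ <= _](gtr0_norm c0) -normvZ scalemxAr.
  rewrite -[X in _ <= X * _](gtr0_norm c0) -normvZ.
  have [|T hT] := hs (th + c *: u) _ (eps + 1) ltac:(by rewrite ltrDl).
    rewrite addrC addKr normvZ gtr0_norm // /c mulrAC ler_pdivrMr //.
    by rewrite ler_wpM2l ?lerDl // ltW.
  apply: (symmetric_bounded_nonexpansive symM (C := eps + 1) (T := T)) => t /hT.
  by apply: le_trans; apply: exp_dist_ge => // S bS; case: (hf S bS 0 0).
(* Cauchy-Schwarz and [nonexp] give -|u|^2 <= M u . u = |u|^2 - eta (Hm u . u). *)
have rayleigh : eta * dotv (Hm *m u) u <= 2 * dotv u u.
  have := normr_dotv_le (M *m u) u; rewrite ler_norml => /andP[+ _].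
  rewrite /M /mean_step -/Hm mulmxBl mul1mx dotvBl -scalemxAl dotvZl => h1.
  have : normv (M *m u) * normv u <= dotv u u.
    by rewrite -sqr_normv expr2 ler_wpM2r ?normv_ge0.
  rewrite /M /mean_step -/Hm mulmxBl mul1mx -scalemxAl; move: h1; lra.
rewrite mulrAC ler_pdivlMr // mulrC; apply: le_trans rayleigh.
rewrite ler_pM2l // HmE.
set m := _ / _; pose q j := net_lin th (x j) u.
have nR0 : 0 < n%:R :> R by rewrite ltr0n.
rewrite -/q ler_pdivlMr // -subr_ge0.
(* Jensen's inequality as nonnegativity of the variance of the [q j]. *)
have -> : \sum_j q j * q j - m ^+ 2 * n%:R = \sum_j (q j - m) ^+ 2.
  have mE : \sum_j q j = m * n%:R by rewrite /m divfK.
  rewrite [RHS](eq_bigr (fun j => q j * q j - (2 * m) * q j + m ^+ 2)) => [|j _]; last by ring.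
  rewrite big_split sumrB /= -mulr_sumr mE sumr_const card_ord -[m ^+ 2 *+ n]mulr_natr.
  by ring.
by apply: sumr_ge0 => j _; apply: sqr_ge0.
Qed.

End Stability.

(** * Canonical coefficients compared with the neurons of a network *)

Section RidgeComparison.
Variables (R : realType) (d : nat).

(** The [size p] integers from 0 on are more than the roots of a nonzero [p]. *)
Lemma exists_nonroot (p : {poly R}) : p != 0 -> exists t, p.[t] != 0.
Proof.
move=> p0; pose rs : seq R := [seq i%:R | i <- iota 0 (size p)].
have : ~~ all (root p) rs.
  apply/negP => hall; have := max_poly_roots p0 hall.
  rewrite map_inj_uniq ?iota_uniq; last first.
    by move=> i j /eqP; rewrite eqr_nat => /eqP.
  by move=> /(_ isT); rewrite size_map size_iota ltnn.
by case/allPn => t _ nt; exists t.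
Qed.

(* The point is sought on the curve [c(t) = (t, t^2, ..., t^d)] projected onto the
   hyperplane; each condition to avoid is then a nonzero polynomial in [t]. *)
Lemma hyperplane_generic_point (I : finType) (v : 'cV[R]_d) (b : R)
    (u : I -> 'cV[R]_d) (be : I -> R) :
  normv v = 1 ->
  exists2 z : 'cV[R]_d, dotv z v = b &
    forall i, dotv z (u i) + be i = 0 ->
      u i = dotv (u i) v *: v /\ be i = - (dotv (u i) v * b).
Proof.
move=> v1; have vv : dotv v v = 1 by rewrite -sqr_normv v1 expr1n.
pose w i := u i - dotv (u i) v *: v.
(* The i-th affine function at the projection of c(t). Exponents start at 1, so the constant
   coefficient is separate from the components of [u i] orthogonal to [v]. *)
pose P i : {poly R} := \sum_(l < d) (w i l 0)%:P * 'X^(l.+1)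
  + (dotv (u i) v * b + be i)%:P.
have P0 i : P i = 0 -> u i = dotv (u i) v *: v /\ be i = - (dotv (u i) v * b).
  move=> Pi; have coefP m : (P i)`_m = 0 by rewrite Pi coef0.
  split.
    apply/eqP; rewrite -subr_eq0; apply/eqP/colP => l; rewrite [RHS]mxE -/(w i).
    have := coefP l.+1; rewrite coefD coef_sum coefC addr0.
    rewrite (bigD1 l) //= coefCM coefXn eqxx mulr1 big1 ?addr0 // => l' ne.
    by rewrite coefCM coefXn eqSS val_eqE eq_sym (negPf ne) mulr0.
  have := coefP 0%N; rewrite coefD coef_sum coefC big1 ?add0r /=; last first.
    by move=> l _; rewrite coefCM coefXn mulr0.
  by move/eqP; rewrite addrC addr_eq0 => /eqP.
have [t ht] : exists t : R, (\prod_(i | P i != 0) P i).[t] != 0.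
  by apply: exists_nonroot; apply/prodf_neq0.
pose c : 'cV[R]_d := \col_l t ^+ l.+1.
exists (c + (b - dotv c v) *: v); first by rewrite dotvDl dotvZl vv; ring.
move=> i hi; apply: P0; apply/eqP/negP => /negP Pi; move: ht.
rewrite horner_prod (bigD1 i) //= mulf_eq0 negb_or => /andP[/eqP + _]; apply.
rewrite -[RHS]hi /P hornerD horner_sum hornerC.
transitivity (dotv c (w i) + (dotv (u i) v * b + be i)).
  congr (_ + _); apply: eq_bigr => l _.
  by rewrite hornerM hornerC hornerXn /c [in RHS]mxE mulrC.
by rewrite /w dotvC dotvBl dotvDl !dotvZl !(dotvC _ c) (dotvC v (u i)); ring.
Qed.

(** Second differences detect kinks: they vanish when the increment does not reach the kink, and
    equal its length when centred on it. *)
Lemma relu_second_diff_off (s t : R) :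
  `|t| < `|s| -> relu (s + t) + relu (s - t) - 2 * relu s = 0.
Proof.
move=> h; rewrite relu_near // relu_near ?normrN // reluE; ring.
Qed.

Lemma relu_second_diff_on (t : R) : relu (0 + t) + relu (0 - t) - 2 * relu 0 = `|t|.
Proof.
rewrite add0r sub0r !reluE; case: (ger0P t) => ht.
  by rewrite !mulr0 !subr0; case: ltrP => h1; case: ltrP => h2 /=; lra.
by case: ltrP => h1; case: ltrP => h2 /=; lra.
Qed.

Variables (k m : nat).
Variables (w : 'I_k -> R) (u : 'I_k -> 'cV[R]_d) (be : 'I_k -> R) (c0 : R).
Variables (f : 'cV[R]_d -> R) (a : 'I_m -> R) (v : 'I_m -> 'cV[R]_d) (b : 'I_m -> R).
Variables (q : 'cV[R]_d) (c : R).
Hypothesis f_net : forall z, f z = \sum_(i < k) w i * relu (dotv z (u i) + be i) + c0.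
Hypothesis f_rep : canonical_rep f a v b q c.

(** The factor may be negative, since opposite orientations share a kink. Requiring it to be nonzero
    excludes neurons with zero weight and bias, which would match every ridge. *)
Definition same_hyperplane (i : 'I_k) (p : 'I_m) : bool :=
  [&& dotv (u i) (v p) != 0, u i == dotv (u i) (v p) *: v p &
      be i == - (dotv (u i) (v p) * b p)].

Lemma unit_collinear (v1 v2 : 'cV[R]_d) (s : R) :
  normv v1 = 1 -> normv v2 = 1 -> v1 = s *: v2 -> s = 1 \/ s = -1.
Proof.
move=> n1 n2 e; have := congr1 (@normv R d) e; rewrite normvZ n1 n2 mulr1 => /esym.
by case: (ger0P s) => _ h; [left | right; rewrite -h opprK].
Qed.

(** At a generic point of the p-th hyperplane the second difference of [f] along [v p] is t times
    [a p] in one representation and t times the sum of [w i] times the absolute slopes in the other.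
    The triangle inequality concludes. *)
Lemma canonical_coef_le (p : 'I_m) :
  `|a p| <= \sum_(i < k | same_hyperplane i p) `|w i| * `|dotv (u i) (v p)|.
Proof.
have [nv [_ [dist rep]]] := f_rep.
have vv p' : dotv (v p') (v p') = 1 by rewrite -sqr_normv nv expr1n.
pose U (i : 'I_k + 'I_m) := match i with inl i => u i | inr p' => v p' end.
pose Be (i : 'I_k + 'I_m) := match i with inl i => be i | inr p' => - b p' end.
have [z zp gen] := hyperplane_generic_point (b p) U Be (nv p).
pose s i := dotv z (U i) + Be i.
pose sl i := dotv (U i) (v p).
(* So small that no affine function of either family that is nonzero at [z] changes sign on the
   segment; 1 is a dummy bound for those vanishing there. *)
have [t t0 ht] := @finite_pos_lower_bound R ('I_k + 'I_m)%type
  (fun i => if s i == 0 then 1 else `|s i| / (2 * (`|sl i| + 1)))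
  ltac:(by move=> i /=; case: ifPn => // h;
    rewrite divr_gt0 ?normr_gt0 // mulr_gt0 // ltr_wpDl).
have small i : s i != 0 -> `|t * sl i| < `|s i|.
  move=> si; have := ht i; rewrite (negPf si) ler_pdivlMr ?mulr_gt0 ?ltr_wpDl //.
  rewrite normrM gtr0_norm // => h; have := normr_ge0 (sl i); nra.
have along i r : dotv (z + r *: v p) (U i) + Be i = s i + r * sl i.
  by rewrite dotvDl dotvZl (dotvC (v p)) /s /sl; ring.
have sdiff i : relu (dotv (z + t *: v p) (U i) + Be i)
   + relu (dotv (z + - t *: v p) (U i) + Be i) - 2 * relu (dotv z (U i) + Be i)
   = if s i == 0 then t * `|sl i| else 0.
  rewrite !along mulNr -/(s i); case: eqP => [->|/eqP /small].
    by rewrite relu_second_diff_on normrM gtr0_norm.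
  exact: relu_second_diff_off.
have sp : s (inr p) = 0 by rewrite /s /= zp subrr.
have spn p' : p' != p -> s (inr p') != 0.
  move=> ne; apply/negP => /eqP /gen /= [e1 e2].
  have [d1 d2] := dist _ _ ne.
  case: (unit_collinear (nv p') (nv p) e1) => e3; move: e1 e2; rewrite e3.
    by rewrite scale1r mul1r => e1 /oppr_inj e2; move: d1; rewrite e1 e2 eqxx.
  rewrite scaleN1r mulN1r opprK => e1 /eqP; rewrite eqr_oppLR => /eqP e2.
  by move: d2; rewrite e1 e2 eqxx.
have D1 : f (z + t *: v p) + f (z + - t *: v p) - 2 * f z = t * a p.
  rewrite !rep.
  have -> : forall A1 A2 A3 : R, A1 + dotv q (z + t *: v p) + c
     + (A2 + dotv q (z + - t *: v p) + c) - 2 * (A3 + dotv q z + c)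
     = A1 + A2 - 2 * A3 by move=> *; rewrite !dotvDr !dotvZr; ring.
  rewrite mulr_sumr -big_split -sumrB (bigD1 p) //= big1 => [|p' ne].
    have := sdiff (inr p); rewrite sp eqxx /= /sl /= vv normr1 mulr1 => h.
    rewrite -[X in _ = X * _]h.
    by rewrite !(dotvC (v p)) addr0; ring.
  have := sdiff (inr p'); rewrite (negPf (spn _ ne)) /= => h.
  by rewrite -[RHS](mulr0 (a p')) -h !(dotvC (v p')); ring.
have D2 : f (z + t *: v p) + f (z + - t *: v p) - 2 * f z
    = t * \sum_(i < k | s (inl i) == 0) w i * `|sl (inl i)|.
  rewrite !f_net.
  have -> : forall A1 A2 A3 : R, A1 + c0 + (A2 + c0) - 2 * (A3 + c0)
     = A1 + A2 - 2 * A3 by move=> *; ring.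
  rewrite !mulr_sumr -big_split -sumrB [RHS]big_mkcond; apply: eq_bigr => i _ /=.
  have := sdiff (inl i); case: ifP => _ h.
    by rewrite [RHS]mulrCA -h /=; ring.
  by rewrite -[RHS](mulr0 (w i)) -h /=; ring.
have -> : a p = \sum_(i < k | s (inl i) == 0) w i * `|sl (inl i)|.
  by apply: (mulfI (lt0r_neq0 t0)); rewrite -D1 -D2.
apply: le_trans (ler_norm_sum _ _ _) _.
rewrite big_mkcond [leRHS]big_mkcond; apply: ler_sum => i _.
case: eqP => [si|_]; last by case: ifP => // _; rewrite mulr_ge0.
rewrite normrM normr_id /sl /=; case: ifP => //; rewrite /same_hyperplane.
(* By genericity, a neuron vanishing at [z] without matching the ridge has slope zero. *)
have [/= <- <-] := gen _ si; rewrite !eqxx !andbT => /negbFE /eqP ->.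
by rewrite normr0 mulr0.
Qed.

(** Two ridges matched by one neuron agree up to orientation, which a canonical representation
    forbids. Each neuron is thus charged at most once. *)
Lemma same_hyperplane_inj (i : 'I_k) (p p' : 'I_m) :
  same_hyperplane i p -> same_hyperplane i p' -> p = p'.
Proof.
have [nv [_ [dist _]]] := f_rep.
move=> /and3P[s0 /eqP eu /eqP eb] /and3P[s0' /eqP eu' /eqP eb'].
apply/eqP/negP => /negP /dist [d1 d2].
set s := dotv (u i) (v p) in s0 eu eb; set s' := dotv (u i) (v p') in s0' eu' eb'.
have ev : v p = (s^-1 * s') *: v p' by rewrite -scalerA -eu' eu scalerK.
have ebb : b p = s^-1 * s' * b p'.
  by apply: (mulfI s0); rewrite !mulrA mulfV // mul1r; apply: oppr_inj; rewrite -eb eb'.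
case: (unit_collinear (nv p) (nv p') ev) => e; move: ev ebb; rewrite e.
  by rewrite scale1r mul1r => e1 e2; move: d1; rewrite e1 e2 eqxx.
by rewrite scaleN1r mulN1r => e1 e2; move: d2; rewrite e1 e2 eqxx.
Qed.

(** [W] extends the bound on [g] to unnormalised neurons. Insert the coefficient bound and exchange
    the sums: every neuron keeps at most one ridge. *)
Lemma canonical_norm_le (g W : 'cV[R]_d -> R -> R) :
  (forall v b, 0 <= g v b) ->
  (forall (s : R) v b, `|s| * g v b <= W (s *: v) (- (s * b))) ->
  \sum_p `|a p| * g (v p) (b p) <= \sum_(i < k) `|w i| * W (u i) (be i).
Proof.
move=> g0 gW.
have W0 i : 0 <= W (u i) (be i).
  have := gW 1 (u i) (- be i); rewrite normr1 scale1r !mul1r opprK.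
  exact: le_trans (g0 _ _).
apply: le_trans (ler_sum _ (fun p _ => ler_wpM2r (g0 _ _) (canonical_coef_le p))) _.
under eq_bigr do rewrite mulr_suml.
rewrite (exchange_big_dep predT) //=; apply: ler_sum => i _.
case: (pickP (same_hyperplane i)) => [p hp|none].
  rewrite (big_pred1 p) => [|p']; last first.
    by apply/idP/eqP => [h|->//]; apply: same_hyperplane_inj h hp.
  rewrite -mulrA ler_wpM2l //.
  by case/and3P: hp => _ /eqP eu /eqP eb; rewrite {2}eu eb; apply: gW.
by rewrite big1 ?mulr_ge0 // => p; rewrite none.
Qed.

End RidgeComparison.

(** * The weight [gw] in terms of unnormalised neurons *)

Section NeuronWeights.
Variables (R : realType) (d n : nat) (x : 'I_n -> 'cV[R]_d).
Hypothesis n_gt0 : (0 < n)%N.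

(* [gtilde] without the normalisation of the direction; it is what the mean
   gradient of a network sees of a neuron. *)
Definition neuron_weight (u : 'cV[R]_d) (be : R) : R :=
  (\sum_j relu (dotv (x j) u + be)) / n%:R
  * Num.sqrt (dotv (n%:R^-1 *: \sum_(j in active x u (- be)) x j)
                   (n%:R^-1 *: \sum_(j in active x u (- be)) x j)
              + prob_act x u (- be) ^+ 2).

Lemma neuron_weight_ge0 u be : 0 <= neuron_weight u be.
Proof.
rewrite mulr_ge0 ?sqrtr_ge0 // divr_ge0 //.
by apply: sumr_ge0 => j _; apply: relu_ge0.
Qed.

Lemma gtilde_ge0 v b : 0 <= gtilde x v b.
Proof.
rewrite /gtilde mulr_ge0 ?sqrtr_ge0 // mulr_ge0 ?sqr_ge0 // divr_ge0 //.
by apply: sumr_ge0 => j; rewrite inE subr_ge0 => /ltW.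
Qed.

(** Of the two probability factors in [gtilde], one turns the conditional margin into a mean over
    all data; the other enters the root and does the same for the conditional mean. *)
Lemma gtilde_neuron_weight (s : R) v b : 0 < s ->
  s * gtilde x v b = neuron_weight (s *: v) (- (s * b)).
Proof.
move=> s0; rewrite /neuron_weight opprK.
have actE : active x (s *: v) (s * b) = active x v b.
  by apply/setP => j; rewrite !inE dotvZr ltr_pM2l.
rewrite /prob_act actE /gtilde /cond_margin /cond_mean /prob_act.
set A := active x v b; set Z := \sum_(j in A) x j.
have -> : \sum_j relu (dotv (x j) (s *: v) + - (s * b))
    = s * \sum_(j in A) (dotv (x j) v - b).
  rewrite mulr_sumr [RHS]big_mkcond; apply: eq_bigr => j _.
  rewrite inE dotvZr -mulrBr reluE pmulr_rgt0 // subr_gt0.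
  by case: ifP => _; rewrite ?mul1r ?mul0r.
have nR : n%:R != 0 :> R by rewrite pnatr_eq0 -lt0n.
(* With no active point the conditional expectations are divisions by zero, valued 0, and both sides
   vanish. *)
have [A0|Apos] := posnP #|A|.
  rewrite A0 !mul0r expr0n /= !mul0r mulr0.
  by rewrite big_pred0 ?mulr0 ?mul0r // => j; rewrite (cards0_eq A0) inE.
have AR : #|A|%:R != 0 :> R by rewrite pnatr_eq0 -lt0n.
rewrite sqr_normv !dotvZl !dotvZr.
have -> : n%:R^-1 * (n%:R^-1 * dotv Z Z) + (#|A|%:R / n%:R) ^+ 2
   = (#|A|%:R / n%:R) ^+ 2 * (#|A|%:R^-1 * (#|A|%:R^-1 * dotv Z Z) + 1).
  by field; rewrite nR AR.
rewrite sqrtrM ?sqr_ge0 // sqrtr_sqr ger0_norm ?divr_ge0 //.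
by field; rewrite nR AR.
Qed.

Lemma gw_ge0 v b : 0 <= gw x v b.
Proof. by rewrite /gw le_min !gtilde_ge0. Qed.

(** The minimum in [gw] serves both signs: a negative s is the positive multiple -s of the reversed
    ridge (-v, -b). *)
Lemma gw_neuron_weight (s : R) v b :
  `|s| * gw x v b <= neuron_weight (s *: v) (- (s * b)).
Proof.
have [s0|s0|->] := ltrgt0P s.
- by rewrite -gtilde_neuron_weight // ler_pM2l // ge_min lexx.
- have -> : s *: v = - s *: - v by rewrite scaleNr scalerN opprK.
  have -> : s * b = - s * - b by rewrite mulrNN.
  by rewrite -gtilde_neuron_weight ?oppr_gt0 // ler_pM2l ?oppr_gt0 // ge_min lexx orbT.
- by rewrite mul0r neuron_weight_ge0.
Qed.

End NeuronWeights.

(** * The mean parameter gradient of the network and its norm *)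

Section MeanGradient.
Variables (R : realType) (d n k : nat) (x : 'I_n -> 'cV[R]_d).
Variable th : 'cV[R]_(npar d k).
Hypothesis n_gt0 : (0 < n)%N.

Definition weight_vec (i : 'I_k) : 'cV[R]_d := \col_l par_w1 th i l.

Lemma preact_dotv i z : preact th i z = dotv z (weight_vec i) + par_b1 th i.
Proof. by congr (_ + _); apply: eq_bigr => l _; rewrite mxE. Qed.

(** The output bias contributes the coordinate 1, the origin of the term - 1/2 in the final
    bound. *)
Definition mean_gradient : 'cV[R]_(npar d k) :=
  mkpar (fun i l => par_w2 th i * ((\sum_j gate th i (x j) * x j l 0) / n%:R))
        (fun i => par_w2 th i * ((\sum_j gate th i (x j)) / n%:R))
        (fun i => (\sum_j gate th i (x j) * preact th i (x j)) / n%:R)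
        1.

Lemma mean_gradientE u :
  (\sum_j net_lin th (x j) u) / n%:R = dotv mean_gradient u.
Proof.
have nR : n%:R != 0 :> R by rewrite pnatr_eq0 -lt0n.
rewrite dotv_par par_b2_mkpar mul1r /net_lin big_split /= sumr_const card_ord.
rewrite mulrDl -[par_b2 u *+ n]mulr_natr mulfK //; congr (_ + _).
rewrite exchange_big mulr_suml /=; apply: eq_bigr => i _.
rewrite par_b1_mkpar par_w2_mkpar.
have -> : \sum_(l < d) par_w1 mean_gradient i l * par_w1 u i l
    = par_w2 th i * ((\sum_j gate th i (x j) * \sum_(l < d) x j l 0 * par_w1 u i l)
        / n%:R).
  under [in RHS]eq_bigr do rewrite mulr_sumr.
  rewrite exchange_big mulr_suml mulr_sumr; apply: eq_bigr => l _ /=.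
  rewrite par_w1_mkpar -!mulrA; congr (_ * _); rewrite !mulr_suml.
  by apply: eq_bigr => j _; ring.
rewrite !mulr_suml !mulr_sumr !mulr_suml -!big_split /=; apply: eq_bigr => j _.
by rewrite /preact; ring.
Qed.

Lemma mean_gradient_normE :
  dotv mean_gradient mean_gradient = 1 +
  \sum_(i < k)
    (par_w2 th i ^+ 2 *
       (dotv (n%:R^-1 *: \sum_(j in active x (weight_vec i) (- par_b1 th i)) x j)
             (n%:R^-1 *: \sum_(j in active x (weight_vec i) (- par_b1 th i)) x j)
        + prob_act x (weight_vec i) (- par_b1 th i) ^+ 2)
     + ((\sum_j relu (dotv (x j) (weight_vec i) + par_b1 th i)) / n%:R) ^+ 2).
Proof.
rewrite dotv_par par_b2_mkpar mulr1 addrC; congr (_ + _); apply: eq_bigr => i _.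
rewrite par_b1_mkpar par_w2_mkpar.
have actE j : (j \in active x (weight_vec i) (- par_b1 th i)) = (0 < preact th i (x j)).
  by rewrite inE preact_dotv -subr_gt0 opprK.
have -> : \sum_j gate th i (x j) * preact th i (x j)
    = \sum_j relu (dotv (x j) (weight_vec i) + par_b1 th i).
  by apply: eq_bigr => j _; rewrite -preact_dotv reluE.
have -> : (\sum_j gate th i (x j)) / n%:R = prob_act x (weight_vec i) (- par_b1 th i).
  rewrite /prob_act -sum1_card natr_sum [in RHS]big_mkcond; congr (_ / _).
  by apply: eq_bigr => j _; rewrite actE /gate; case: ltrP.
have -> : \sum_(l < d) par_w1 mean_gradient i l * par_w1 mean_gradient i l
   = par_w2 th i ^+ 2 *
     dotv (n%:R^-1 *: \sum_(j in active x (weight_vec i) (- par_b1 th i)) x j)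
          (n%:R^-1 *: \sum_(j in active x (weight_vec i) (- par_b1 th i)) x j).
  rewrite mulr_sumr; apply: eq_bigr => l _; rewrite par_w1_mkpar mxE summxE.
  have -> : \sum_j gate th i (x j) * x j l 0
      = \sum_(j in active x (weight_vec i) (- par_b1 th i)) x j l 0.
    rewrite [RHS]big_mkcond; apply: eq_bigr => j _; rewrite actE /gate.
    by case: ltrP; rewrite ?mul1r ?mul0r.
  by ring.
by ring.
Qed.

Lemma mean_gradient_norm_ge :
  1 + 2 * \sum_(i < k) `|par_w2 th i| * neuron_weight x (weight_vec i) (par_b1 th i)
  <= dotv mean_gradient mean_gradient.
Proof.
rewrite mean_gradient_normE lerD2l mulr_sumr; apply: ler_sum => i _.
rewrite /neuron_weight.
set m := _ / n%:R; set A := dotv _ _ + _ ^+ 2.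
have A0 : 0 <= A by rewrite /A addr_ge0 ?dotv_ge0 ?sqr_ge0.
rewrite -{2}(sqr_sqrtr A0) -[par_w2 th i ^+ 2](real_normK (num_real _)).
(* AM-GM between the first layer part w2^2 A and the output weight part m^2 of neuron [i]. *)
have := sqr_ge0 (`|par_w2 th i| * Num.sqrt A - m); nra.
Qed.

End MeanGradient.

Theorem theorem1 (R : realType) (d n k B : nat)
  (x : 'I_n -> 'cV[R]_d) (y : 'I_n -> R) (eta : R) (f : 'cV[R]_d -> R) :
  (0 < n)%N -> (0 < B)%N -> (B <= n)%N -> 0 < eta ->
  stable_solution k B x y eta f ->
  (forall j : 'I_n, ~ on_knot f (x j)) ->
  forall (m : nat) (a : 'I_m -> R) (v : 'I_m -> 'cV[R]_d) (b : 'I_m -> R)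
         (q : 'cV[R]_d) (c : R),
    canonical_rep f a v b q c ->
    rnorm_rep x a v b <= eta^-1 - 2^-1.
Proof.
move=> n0 B0 Bn eta0 [fxy [th [netf stab]]] _ m a v b q c rep.
have interp j : net th (x j) = y j by rewrite netf fxy.
pose gr := mean_gradient x th.
have gr1 := mean_gradient_norm_ge x th; rewrite -/gr in gr1.
have W0 : 0 <= \sum_(i < k) `|par_w2 th i|
    * neuron_weight x (weight_vec th i) (par_b1 th i).
  by apply: sumr_ge0 => i _; rewrite mulr_ge0 ?neuron_weight_ge0.
(* Tested on [gr] itself, stability bounds |gr|^4 by (2 / eta) |gr|^2, and |gr|^2 >= 1 permits the
   division. *)
have gr_le : dotv gr gr <= 2 / eta.
  have := stable_mean_gradient_le n0 B0 Bn eta0 interp stab gr.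
  by rewrite mean_gradientE // -/gr expr2 ler_pM2r //; lra.
have f_net z : f z = \sum_(i < k) par_w2 th i
    * relu (dotv z (weight_vec th i) + par_b1 th i) + par_b2 th.
  by rewrite -netf netE; congr (_ + _); apply: eq_bigr => i _; rewrite preact_dotv.
have := canonical_norm_le f_net rep (gw_ge0 x) (gw_neuron_weight x n0).
by rewrite /rnorm_rep; lra.
Qed.
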